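(* Let $\bm{W}_\ell^{(a)}$ and $\bm{W}_\ell^{(b)}$ be real matrices of the same size (the weights of the $\ell$-th layers of two models) with singular value decompositions $\bm{W}_\ell^{(a)}=\sum_i \bm{u}_{\ell,i}^{(a)}s_{\ell,i}^{(a)}(\bm{v}_{\ell,i}^{(a)})^\top$ and $\bm{W}_\ell^{(b)}=\sum_i \bm{u}_{\ell,i}^{(b)}s_{\ell,i}^{(b)}(\bm{v}_{\ell,i}^{(b)})^\top$. Let $\sigma$ be an activation function that is Lipschitz continuous with constant $C>0$, and let $\bm{z}$ be a random input vector, the same for both layers. Then $$\mathbb{E}\|\sigma(\bm{W}_\ell^{(a)}\bm{z})-\sigma(\bm{W}_\ell^{(b)}\bm{z})\|\le C\bigg(\sum_i (s_{\ell,i}^{(a)})^2\,\mathbb{E}\big[((\bm{v}_{\ell,i}^{(a)})^\top\bm{z})^2\big]+\sum_i (s_{\ell,i}^{(b)})^2\,\mathbb{E}\big[((\bm{v}_{\ell,i}^{(b)})^\top\bm{z})^2\big]-2\sum_{i,j}s_{\ell,i}^{(a)}s_{\ell,j}^{(b)}\,(\bm{u}_{\ell,i}^{(a)})^\top\bm{u}_{\ell,j}^{(b)}\;\mathbb{E}\big[(\bm{v}_{\ell,i}^{(a)})^\top\bm{z}\,(\bm{v}_{\ell,j}^{(b)})^\top\bm{z}\big]\bigg)^{1/2}.$$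
   Context: $\|\cdot\|$ is the Euclidean norm. In each singular value decomposition the $s$'s are the singular values, and the $\bm{u}$'s and $\bm{v}$'s are the corresponding orthonormal families of left and right singular vectors. The activation function $\sigma$ acts on the vectors $\bm{W}_\ell^{(a)}\bm{z}$ and $\bm{W}_\ell^{(b)}\bm{z}$, giving the outputs of the two layers. The expectation $\mathbb{E}$ is over the random vector $\bm{z}$. *)

(* Defs.v *)
From mathcomp Require Import all_boot all_order all_algebra.
From mathcomp Require Import all_classical all_reals all_analysis.

Set Implicit Arguments.
Unset Strict Implicit.
Unset Printing Implicit Defensive.

Import Order.TTheory GRing.Theory Num.Theory.
Local Open Scope ring_scope.

Definition dotcv (R : realType) (n : nat) (x y : 'cV[R]_n) : R :=
  (x^T *m y) ord0 ord0.

(* The library norm on matrices is the sup norm, hence this definition (and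
   that of [elipschitz], which cannot be the library's [k.-lipschitz]). *)
Definition enorm (R : realType) (n : nat) (x : 'cV[R]_n) : R :=
  Num.sqrt (\sum_(i < n) x i ord0 ^+ 2).

Definition elipschitz (R : realType) (m p : nat) (C : R)
    (f : 'cV[R]_m -> 'cV[R]_p) : Prop :=
  forall x y, enorm (f x - f y) <= C * enorm (x - y).

(* Entrywise application of a C-Lipschitz scalar function, the usual activation
   function of a layer, is C-Lipschitz for the Euclidean norm. *)
Lemma elipschitz_map_mx (R : realType) (m : nat) (C : R) (f : R -> R) :
  0 <= C -> (forall x y, `|f x - f y| <= C * `|x - y|) ->
  elipschitz C (fun x : 'cV[R]_m => map_mx f x).
Proof.
move=> C0 fC x y; rewrite /enorm -[C in leRHS]ger0_norm// -sqrtr_sqr.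
rewrite -sqrtrM ?sqr_ge0// ler_wsqrtr// mulr_sumr ler_sum// => i _.
rewrite !mxE -exprMn -[leLHS]real_normK ?num_real//.
rewrite -[leRHS]real_normK ?num_real// ler_sqr ?nnegrE//.
by rewrite normrM (ger0_norm C0) fC.
Qed.

Definition orthonormal_family (R : realType) (n r : nat)
    (u : 'I_r -> 'cV[R]_n) : Prop :=
  forall i j, dotcv (u i) (u j) = (i == j)%:R.

(* The number r of terms is arbitrary: r = \rank W is the compact decomposition,
   and r = minn m n the thin one, where singular values may vanish. *)
Record is_svd (R : realType) (m n r : nat) (W : 'M[R]_(m, n))
    (u : 'I_r -> 'cV[R]_m) (s : 'I_r -> R) (v : 'I_r -> 'cV[R]_n) : Prop := {
  svd_ge0 : forall i, 0 <= s i;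
  svd_left : orthonormal_family u;
  svd_right : orthonormal_family v;
  svd_eq : W = \sum_(i < r) s i *: (u i *m (v i)^T)
}.

(* Main.v *)
(* The Lipschitz bound gives |sigma (Wa z) - sigma (Wb z)|^2 <=
   C^2 |Wa z - Wb z|^2, and expanding |Wa z - Wb z|^2 along the two singular
   value decompositions, with orthonormality of the left singular vectors,
   yields the expression under the square root. The passage from E f to
   (E f^2)^(1/2) is AM-GM, 2 f <= f^2 / t + t, optimized over t > 0;
   this way the measurability of sigma never matters. *)
Require Import Defs.
From mathcomp Require Import all_boot all_order all_algebra.
From mathcomp Require Import all_classical all_reals all_analysis.
From mathcomp Require Import measurable_realfun ring lra.

Set Implicit Arguments.
Unset Strict Implicit.
Unset Printing Implicit Defensive.

Import Order.TTheory GRing.Theory Num.Theory.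
Local Open Scope ring_scope.

Lemma dotcvE (R : realType) (n : nat) (x y : 'cV[R]_n) :
  dotcv x y = \sum_k x k ord0 * y k ord0.
Proof. by rewrite /dotcv mxE; under eq_bigr do rewrite mxE. Qed.

Lemma dotcvBB (R : realType) (n : nat) (x y : 'cV[R]_n) :
  dotcv (x - y) (x - y) = dotcv x x + dotcv y y - 2 * dotcv x y.
Proof.
rewrite !dotcvE mulr_sumr -big_split/= -sumrB; apply: eq_bigr => k _.
by rewrite !mxE; ring.
Qed.

Lemma dotcv_sum (R : realType) (n p q : nat)
    (a : 'I_p -> R) (u : 'I_p -> 'cV[R]_n)
    (b : 'I_q -> R) (v : 'I_q -> 'cV[R]_n) :
  dotcv (\sum_i a i *: u i) (\sum_j b j *: v j) =
  \sum_i \sum_j a i * b j * dotcv (u i) (v j).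
Proof.
rewrite dotcvE (eq_bigr (fun k => \sum_i \sum_j
    a i * b j * (u i k ord0 * v j k ord0))) => [|k _].
  rewrite exchange_big/=; apply: eq_bigr => i _.
  rewrite exchange_big/=; apply: eq_bigr => j _.
  by rewrite dotcvE mulr_sumr.
rewrite !summxE big_distrlr/=; apply: eq_bigr => i _; apply: eq_bigr => j _.
by rewrite !mxE; ring.
Qed.

Lemma enorm_sqr (R : realType) (n : nat) (x : 'cV[R]_n) :
  enorm x ^+ 2 = dotcv x x.
Proof.
rewrite dotcvE sqr_sqrtr ?sumr_ge0// => k _.
exact: sqr_ge0.
Qed.

Lemma svd_mulmx (R : realType) (m n r : nat) (W : 'M[R]_(m, n))
    (u : 'I_r -> 'cV[R]_m) (s : 'I_r -> R) (v : 'I_r -> 'cV[R]_n) x :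
  is_svd W u s v -> W *m x = \sum_i (s i * dotcv (v i) x) *: u i.
Proof.
move=> [_ _ _ ->]; rewrite mulmx_suml; apply: eq_bigr => i _.
(* The product [(v i)^T *m x] is a 1 x 1 matrix; it becomes the scalar that multiplies [u i]. *)
by rewrite -scalemxAl -mulmxA (mx11_scalar (_ *m x)) mul_mx_scalar scalerA.
Qed.

(** Pythagoras: in the double sum given by [dotcv_sum], orthonormality of the [u i] leaves only the
    diagonal. *)
Lemma svd_enorm_sqr (R : realType) (m n r : nat) (W : 'M[R]_(m, n))
    (u : 'I_r -> 'cV[R]_m) (s : 'I_r -> R) (v : 'I_r -> 'cV[R]_n) x :
  is_svd W u s v ->
  enorm (W *m x) ^+ 2 = \sum_i s i ^+ 2 * dotcv (v i) x ^+ 2.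
Proof.
move=> svdW; rewrite enorm_sqr (svd_mulmx _ svdW) dotcv_sum.
apply: eq_bigr => i _; rewrite (bigD1 i)//= big1 ?addr0 => [|j ji].
  by rewrite (svd_left svdW) eqxx mulr1 -expr2 exprMn.
by rewrite (svd_left svdW) eq_sym (negbTE ji) mulr0.
Qed.

(** Polarization. The cross term stays a double sum, since vectors [ua i] and [ub j] of two
    different families may have any inner product. *)
Lemma svd_enormB_sqr (R : realType) (m n ra rb : nat) (Wa Wb : 'M[R]_(m, n))
    (ua : 'I_ra -> 'cV[R]_m) (sa : 'I_ra -> R) (va : 'I_ra -> 'cV[R]_n)
    (ub : 'I_rb -> 'cV[R]_m) (sb : 'I_rb -> R) (vb : 'I_rb -> 'cV[R]_n) x :
  is_svd Wa ua sa va -> is_svd Wb ub sb vb ->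
  enorm (Wa *m x - Wb *m x) ^+ 2 =
  \sum_i sa i ^+ 2 * dotcv (va i) x ^+ 2
  + \sum_i sb i ^+ 2 * dotcv (vb i) x ^+ 2
  - 2 * \sum_i \sum_j sa i * sb j * dotcv (ua i) (ub j)
                      * (dotcv (va i) x * dotcv (vb j) x).
Proof.
move=> svda svdb; rewrite enorm_sqr dotcvBB -!enorm_sqr.
rewrite (svd_enorm_sqr _ svda) (svd_enorm_sqr _ svdb); congr (_ - 2 * _).
rewrite (svd_mulmx _ svda) (svd_mulmx _ svdb) dotcv_sum.
by apply: eq_bigr => i _; apply: eq_bigr => j _; ring.
Qed.

Local Open Scope ereal_scope.

(* Unlike [ge0_le_integral], no measurability: the integral of a nonnegative
   function is a supremum over the simple functions below it. *)
Lemma ge0_le_integralT d (T : measurableType d) (R : realType)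
    (mu : {measure set T -> \bar R}) (f g : T -> \bar R) :
  (forall x, 0 <= f x) -> (forall x, f x <= g x) ->
  \int[mu]_x f x <= \int[mu]_x g x.
Proof.
move=> f0 fg; have g0 x : 0 <= g x by exact: le_trans (fg x).
rewrite !ge0_integralTE//; apply: le_ereal_sup => _ [h hf <-].
by exists h => // x; exact: le_trans (fg x).
Qed.

Lemma le_expectation_sqrte d (T : measurableType d) (R : realType)
    (P : probability T R) (f F : T -> R) :
  (forall w, 0 <= f w)%R -> (forall w, f w ^+ 2 <= F w)%R ->
  measurable_fun [set: T] F -> 'E_P[f] <= sqrte 'E_P[F].
Proof.
move=> f0 fF mF.
have F0 w : (0 <= F w)%R by exact: le_trans (sqr_ge0 _) (fF w).
rewrite unlock.
have : 0 <= \int[P]_w (F w)%:E by apply: integral_ge0 => w _; rewrite lee_fin.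
(* An infinite expectation of [F] makes the bound trivial, so [q] is its finite value. *)
case EF : (\int[P]_w (F w)%:E) => [q| |]//=; last by move=> _; rewrite leey.
rewrite lee_fin => q0.
have AMGM (t : R) : (0 < t)%R ->
    \int[P]_w (f w)%:E <= ((q / t + t) / 2)%:E.
  move=> t0; have it0 : (0 <= t^-1 / 2)%R by rewrite divr_ge0 ?invr_ge0 ?ltW.
  apply: (@le_trans _ _ (\int[P]_w ((t^-1 / 2)%:E * (F w)%:E + (t / 2)%:E))).
    apply: ge0_le_integralT => w; first by rewrite lee_fin.
    rewrite -EFinM -EFinD lee_fin.
    have -> : (t^-1 / 2 * F w + t / 2 = (F w + t ^+ 2) / (2 * t))%R.
      by field; rewrite gt_eqF.
    rewrite ler_pdivlMr ?mulr_gt0//.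
    (* AM-GM is [(f w - t) ^+ 2 >= 0], after which [f w ^+ 2] is replaced by its majorant [F w]. *)
    rewrite -subr_ge0; apply: le_trans (sqr_ge0 (f w - t)) _.
    have -> : ((f w - t) ^+ 2 = f w ^+ 2 + t ^+ 2 - f w * (2 * t))%R by ring.
    by rewrite lerB// lerD2r.
  rewrite ge0_integralD//=.
  - rewrite ge0_integralZl_EFin//.
    + rewrite EF integral_cst// [X in _ + _ * X]probability_setT mule1 -EFinM -EFinD lee_fin.
      by rewrite le_eqVlt; apply/orP; left; apply/eqP; field; rewrite gt_eqF.
    + by move=> w _; rewrite lee_fin.
    + exact/measurable_EFinP.
  - by move=> w _; rewrite -EFinM lee_fin mulr_ge0.
  - under eq_fun do rewrite -EFinM.
    by apply/measurable_EFinP; exact: measurable_funM.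
  - by move=> w _; rewrite lee_fin divr_ge0 ?ltW.
(* For [q = 0] the optimal [t] would be 0, which is excluded; every [t = e > 0] gives the bound
   [e / 2], and [e] is arbitrary. *)
move: q0; rewrite le_eqVlt => /predU1P[q0|q0].
  rewrite -q0 sqrtr0; apply/lee_addgt0Pr => e e0; rewrite add0e.
  apply: le_trans (AMGM e e0) _; rewrite -q0 mul0r add0r lee_fin.
  by rewrite ler_pdivrMr//; lra.
(* The minimizer of [q / t + t] is [t = Num.sqrt q], where half of it equals [Num.sqrt q]. *)
have sq0 : (0 < Num.sqrt q)%R by rewrite sqrtr_gt0.
apply: le_trans (AMGM _ sq0) _; rewrite lee_fin -{1}(sqr_sqrtr (ltW q0)).
by rewrite expr2 mulfK ?gt_eqF//; lra.
Qed.

Lemma measurable_dotcv d (T : measurableType d) (R : realType) (n : nat)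
    (z : T -> 'cV[R]_n) (v : 'cV[R]_n) :
  (forall k, measurable_fun [set: T] (fun w => z w k ord0)) ->
  measurable_fun [set: T] (fun w => dotcv v (z w)).
Proof.
move=> mz; under eq_fun do rewrite dotcvE.
by apply: measurable_sum => k; exact: measurable_funM.
Qed.

(** All terms are nonnegative, so linearity holds in the extended reals even when some second
    moments are infinite. *)
Lemma expectation_sum_sqr d (T : measurableType d) (R : realType)
    (P : probability T R) (r : nat) (s : 'I_r -> R) (X : 'I_r -> T -> R) :
  (forall i, measurable_fun [set: T] (X i)) ->
  'E_P[fun w => (\sum_i s i ^+ 2 * X i w ^+ 2)%R] =
  \sum_i (s i ^+ 2)%:E * 'E_P[fun w => (X i w ^+ 2)%R].
Proof.
move=> mX; rewrite unlock.
have mX2 i : measurable_fun [set: T] (fun w => (X i w ^+ 2)%:E).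
  by apply/measurable_EFinP; exact: measurable_funX.
under eq_integral do rewrite -sumEFin.
rewrite ge0_integral_sum//=.
- apply: eq_bigr => i _; under eq_integral do rewrite EFinM.
  by rewrite ge0_integralZl_EFin// ?sqr_ge0// => w _; rewrite lee_fin sqr_ge0.
- move=> i; under eq_fun do rewrite EFinM.
  exact: measurable_funeM.
- by move=> i w _; rewrite lee_fin mulr_ge0 ?sqr_ge0.
Qed.

(* No integrability of [G]: the difference is +oo - finite = +oo when
   [G] has infinite expectation. *)
Lemma expectationB_le d (T : measurableType d) (R : realType)
    (P : probability T R) (G H : T -> R) :
  (forall w, 0 <= G w)%R -> measurable_fun [set: T] G ->
  P.-integrable [set: T] (fun w => (H w)%:E) ->
  'E_P[fun w => (G w - H w)%R] <= 'E_P[G] - 'E_P[H].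
Proof.
move=> G0 mG iH; rewrite unlock.
have fH := integrable_fin_num measurableT iH.
have [Goo|] := eqVneq (\int[P]_w (G w)%:E) +oo.
  by rewrite Goo addye ?leey// -(fineK fH).
rewrite -ltey => Gfin.
have iG : P.-integrable [set: T] (fun w => (G w)%:E).
  apply/integrableP; split; first exact/measurable_EFinP.
  by under eq_integral do rewrite gee0_abs ?lee_fin//.
by under eq_integral do rewrite EFinB; rewrite integralB.
Qed.

Theorem theorem4p2 (R : realType) (m n ra rb : nat)
    (Wa Wb : 'M[R]_(m, n))
    (ua : 'I_ra -> 'cV[R]_m) (sa : 'I_ra -> R) (va : 'I_ra -> 'cV[R]_n)
    (ub : 'I_rb -> 'cV[R]_m) (sb : 'I_rb -> R) (vb : 'I_rb -> 'cV[R]_n)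
    (svda : is_svd Wa ua sa va) (svdb : is_svd Wb ub sb vb)
    (sigma : 'cV[R]_m -> 'cV[R]_m) (C : R) (C_gt0 : (0 < C)%R)
    (sigma_lip : elipschitz C sigma)
    (d : measure_display) (T : measurableType d) (P : probability T R)
    (z : T -> 'cV[R]_n)
    (z_meas : forall k, measurable_fun [set: T] (fun w => z w k ord0))
    (z_mixed : forall i j, P.-integrable [set: T]
       (fun w => (dotcv (va i) (z w) * dotcv (vb j) (z w))%:E)) :
  'E_P[fun w => enorm (sigma (Wa *m z w) - sigma (Wb *m z w))%R]
  <= C%:E * sqrte (
       \sum_(i < ra) (sa i ^+ 2)%:E * 'E_P[fun w => (dotcv (va i) (z w) ^+ 2)%R]
     + \sum_(i < rb) (sb i ^+ 2)%:E * 'E_P[fun w => (dotcv (vb i) (z w) ^+ 2)%R]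
     - 2%:E * \sum_(i < ra) \sum_(j < rb)
         (sa i * sb j * dotcv (ua i) (ub j))%:E
         * 'E_P[fun w => (dotcv (va i) (z w) * dotcv (vb j) (z w))%R]).
Proof.
have mdot v := measurable_dotcv v z_meas.
pose N w := (enorm (Wa *m z w - Wb *m z w) ^+ 2)%R.
pose A w := (\sum_i sa i ^+ 2 * dotcv (va i) (z w) ^+ 2)%R.
pose B w := (\sum_i sb i ^+ 2 * dotcv (vb i) (z w) ^+ 2)%R.
pose H w := (2 * \sum_i \sum_j sa i * sb j * dotcv (ua i) (ub j)
                      * (dotcv (va i) (z w) * dotcv (vb j) (z w)))%R.
have NE : N = (fun w => (A w + B w - H w)%R).
  by apply/funext => w; exact: svd_enormB_sqr.
have A0 w : (0 <= A w)%R by apply: sumr_ge0 => i _; rewrite mulr_ge0 ?sqr_ge0.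
have B0 w : (0 <= B w)%R by apply: sumr_ge0 => i _; rewrite mulr_ge0 ?sqr_ge0.
have mA : measurable_fun [set: T] A.
  apply: measurable_sum => i; apply: measurable_funM => //.
  exact: measurable_funX.
have mB : measurable_fun [set: T] B.
  apply: measurable_sum => i; apply: measurable_funM => //.
  exact: measurable_funX.
have HE w : (H w)%:E = 2%:E * \sum_i \sum_j
    ((sa i * sb j * dotcv (ua i) (ub j))%:E
     * (dotcv (va i) (z w) * dotcv (vb j) (z w))%:E).
  rewrite /H EFinM -sumEFin; congr (_ * _); apply: eq_bigr => i _.
  by rewrite -sumEFin; apply: eq_bigr => j _; rewrite EFinM.
have iij i j := integrableZl measurableT
  (sa i * sb j * dotcv (ua i) (ub j))%R (z_mixed i j).
have ii i := integrable_sum measurableT (index_enum 'I_rb)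
  (fun j (_ : true) => iij i j).
have iS := integrable_sum measurableT (index_enum 'I_ra)
  (fun i (_ : true) => ii i).
(* [H] is a finite linear combination of the products in [z_mixed]; its expectation is therefore
   finite, and subtracting it never produces an indeterminate form. *)
have iH : P.-integrable [set: T] (fun w => (H w)%:E).
  under eq_fun do rewrite HE.
  exact: integrableZl.
(* Measurability of [N] is read off its expansion [A + B - H]. *)
have mN : measurable_fun [set: T] N.
  rewrite NE; apply: measurable_funB; first exact: measurable_funD.
  by apply/measurable_EFinP; case/integrableP: iH.
have EAB : 'E_P[fun w => (A w + B w)%R] = 'E_P[A] + 'E_P[B].
  rewrite unlock; under eq_integral do rewrite EFinD.
  by rewrite ge0_integralD//; [move=> w _; rewrite lee_fin
    |exact/measurable_EFinP|move=> w _; rewrite lee_fin|exact/measurable_EFinP].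
have EH : 'E_P[H] = 2%:E * \sum_(i < ra) \sum_(j < rb)
    (sa i * sb j * dotcv (ua i) (ub j))%:E
    * 'E_P[fun w => (dotcv (va i) (z w) * dotcv (vb j) (z w))%R].
  rewrite unlock; under eq_integral do rewrite HE.
  rewrite integralZl// integral_sum//; congr (_ * _); apply: eq_bigr => i _.
  by rewrite integral_sum//; apply: eq_bigr => j _; rewrite integralZl.
(* The radicand is folded back into the expectation of [A + B] minus that of [H]. *)
rewrite -!expectation_sum_sqr// -/A -/B -EAB -EH.
(* An inequality suffices, because [sqrte] is monotone; it also covers the case where [A + B] has
   infinite expectation. *)
have EN : 'E_P[N] <= 'E_P[fun w => (A w + B w)%R] - 'E_P[H].
  rewrite NE; apply: expectationB_le => //.
  - by move=> w; rewrite addr_ge0.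
  - exact: measurable_funD.
have EN0 : 0 <= 'E_P[N] by apply: expectation_ge0 => w; exact: sqr_ge0.
(* The squared Lipschitz bound makes [C ^+ 2 * N] a measurable majorant of the squared output
   distance. *)
apply: (@le_trans _ _ (sqrte 'E_P[fun w => (C ^+ 2 * N w)%R])).
  apply: le_expectation_sqrte => [w|w|]; first exact: sqrtr_ge0.
  - rewrite -exprMn ler_sqr ?nnegrE ?mulr_ge0 ?sqrtr_ge0 ?(ltW C_gt0)//.
  - exact: measurable_funM.
have -> : 'E_P[fun w => (C ^+ 2 * N w)%R] = (C ^+ 2)%:E * 'E_P[N].
  rewrite unlock; under eq_integral do rewrite EFinM.
  rewrite ge0_integralZl_EFin ?sqr_ge0//.
  - by move=> w _; rewrite lee_fin sqr_ge0.
  - exact/measurable_EFinP.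
rewrite sqrteM ?lee_fin ?sqr_ge0//= sqrtr_sqr gtr0_norm//.
(* [EN0] and [EN] together show that the radicand is nonnegative, as the comparison of square roots
   requires. *)
by rewrite lee_pmul2l ?lte_fin// lee_sqrt// (le_trans EN0).
Qed.
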